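(* For every copula $C\in\mathcal{F}^3_\Pi$ we have $d_\infty(C,\psi(C))\le\frac18$. Moreover, for every $C\in\mathcal{F}^3_\Pi$ the following are equivalent: (a) $d_\infty(C,\psi(C))=\frac18$; (b) either $\mu_C[(0,\tfrac12)\times(0,\tfrac12)\times(0,\tfrac12)]=\mu_C[(0,\tfrac12)\times(\tfrac12,1)\times(\tfrac12,1)]=\mu_C[(\tfrac12,1)\times(\tfrac12,1)\times(0,\tfrac12)]=\mu_C[(\tfrac12,1)\times(0,\tfrac12)\times(\tfrac12,1)]=\tfrac14$, or $\mu_C[(0,\tfrac12)\times(0,\tfrac12)\times(\tfrac12,1)]=\mu_C[(0,\tfrac12)\times(\tfrac12,1)\times(0,\tfrac12)]=\mu_C[(\tfrac12,1)\times(\tfrac12,1)\times(\tfrac12,1)]=\mu_C[(\tfrac12,1)\times(0,\tfrac12)\times(0,\tfrac12)]=\tfrac14$.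
   Context: $\mathbb{I}=[0,1]$, $\lambda$ Lebesgue measure, $\Pi$ the independence copula, $\mu_C$ the probability measure of a copula $C$, $d_\infty(C_1,C_2)=\max_{\mathbf{x}\in\mathbb{I}^3}|C_1(\mathbf{x})-C_2(\mathbf{x})|$. $\mathcal{F}^3_\Pi$ is the class of three-dimensional copulas $C$ whose bivariate marginals satisfy $C_{13}=\Pi=C_{23}$, where $C_{13}(u_1,v)=C(u_1,1,v)$ and $C_{23}(u_2,v)=C(1,u_2,v)$. Points of $\mathbb{I}^3$ are written $(\mathbf{u},v)$, $\mathbf{u}=(u_1,u_2)$. For a three-dimensional copula $C$, $K_C$ is (a version of) the regular conditional distribution of $(U_1,U_2)$ given $U_3=v$, $(U_1,U_2,U_3)\sim C$; $F_{1|3}(u_1|t)=K_C(t,[0,u_1]\times\mathbb{I})$, $F_{2|3}(u_2|t)=K_C(t,\mathbb{I}\times[0,u_2])$; for $\lambda$-a.e. $t$ the conditional copula $C^t_{12;3}$ is the (a.e. unique, since these conditional marginals are continuous for $C\in\mathcal{F}^3_\Pi$) bivariate copula with $K_C(t,[\mathbf{0},\mathbf{u}])=C^t_{12;3}(F_{1|3}(u_1|t),F_{2|3}(u_2|t))$. The partial copula is $C_p(\mathbf{s})=\int_{\mathbb{I}}C^t_{12;3}(\mathbf{s})\,d\lambda(t)$ and the partial vine copula is $\psi(C)(\mathbf{u},v)=\int_{[0,v]}C_p(F_{1|3}(u_1|t),F_{2|3}(u_2|t))\,d\lambda(t)$. *)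

(* Defs.v *)
From mathcomp Require Import all_boot all_order all_algebra.
From mathcomp Require Import all_classical all_reals all_analysis.
Import Order.TTheory GRing.Theory Num.Theory.

Set Implicit Arguments.
Unset Strict Implicit.
Unset Printing Implicit Defensive.

Local Open Scope ring_scope.
Local Open Scope classical_set_scope.

Section CopulaDefs.
Context {R : realType}.

Definition I01 : set R := `[0%R, 1%R].

(* A three-dimensional copula C is identified with its probability measure
   mu_C on I^3 = ((R * R) * R) (points ((u1,u2),v)): mu_C is concentrated on
   I^3 and has uniform (Lebesgue) one-dimensional marginals. *)
Definition is_copula3_measure (mu : probability (R * R * R)%type R) : Prop :=
  mu (I01 `*` I01 `*` I01) = 1%E /\
  (forall a, 0 <= a <= 1 -> mu (`[0%R, a] `*` I01 `*` I01) = a%:E) /\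
  (forall a, 0 <= a <= 1 -> mu (I01 `*` `[0%R, a] `*` I01) = a%:E) /\
  (forall a, 0 <= a <= 1 -> mu (I01 `*` I01 `*` `[0%R, a]) = a%:E).

Definition copula3_fun (mu : probability (R * R * R)%type R) (u1 u2 v : R) : R :=
  fine (mu (`[0%R, u1] `*` `[0%R, u2] `*` `[0%R, v])).

Definition in_F3Pi (mu : probability (R * R * R)%type R) : Prop :=
  is_copula3_measure mu /\
  (forall u1 v, 0 <= u1 <= 1 -> 0 <= v <= 1 -> copula3_fun mu u1 1 v = u1 * v) /\
  (forall u2 v, 0 <= u2 <= 1 -> 0 <= v <= 1 -> copula3_fun mu 1 u2 v = u2 * v).

(* K is a version of the regular conditional distribution of (U1,U2) given U3
   (U3 ~ Lebesgue measure on I). *)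
Definition is_rcd (mu : probability (R * R * R)%type R)
    (K : R.-pker R ~> (R * R)%type) : Prop :=
  forall (A : set (R * R)) (B : set R), measurable A -> measurable B ->
    mu (A `*` B) = (\int[lebesgue_measure]_(t in B `&` I01) K t A)%E.

Definition F13 (K : R.-pker R ~> (R * R)%type) (t u1 : R) : R :=
  fine (K t (`[0%R, u1] `*` I01)).
Definition F23 (K : R.-pker R ~> (R * R)%type) (t u2 : R) : R :=
  fine (K t (I01 `*` `[0%R, u2])).

Definition is_copula2 (D : R -> R -> R) : Prop :=
  (forall x, 0 <= x <= 1 -> D x 0 = 0 /\ D 0 x = 0 /\ D x 1 = x /\ D 1 x = x) /\
  (forall x1 x2 y1 y2, 0 <= x1 -> x1 <= x2 -> x2 <= 1 ->
                       0 <= y1 -> y1 <= y2 -> y2 <= 1 ->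
     0 <= D x2 y2 - D x2 y1 - D x1 y2 + D x1 y1).

Definition is_cond_copulas (K : R.-pker R ~> (R * R)%type)
    (Ct : R -> R -> R -> R) : Prop :=
  {ae (@lebesgue_measure R), forall t, I01 t ->
    is_copula2 (Ct t) /\
    forall u1 u2, 0 <= u1 <= 1 -> 0 <= u2 <= 1 ->
      K t (`[0%R, u1] `*` `[0%R, u2]) = (Ct t (F13 K t u1) (F23 K t u2))%:E}.

Definition partial_copula (Ct : R -> R -> R -> R) (s1 s2 : R) : R :=
  fine (\int[lebesgue_measure]_(t in I01) (Ct t s1 s2)%:E)%E.

Definition psi (K : R.-pker R ~> (R * R)%type) (Ct : R -> R -> R -> R)
    (u1 u2 v : R) : R :=
  fine (\int[lebesgue_measure]_(t in `[0%R, v])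
          (partial_copula Ct (F13 K t u1) (F23 K t u2))%:E)%E.

Definition d_inf_psi (mu : probability (R * R * R)%type R)
    (K : R.-pker R ~> (R * R)%type) (Ct : R -> R -> R -> R) : R :=
  sup [set `|copula3_fun mu x.1.1 x.1.2 x.2 - psi K Ct x.1.1 x.1.2 x.2|
       | x in I01 `*` I01 `*` I01].

Definition lo : set R := `]0%R, (1/2)%R[.
Definition hi : set R := `](1/2)%R, 1%R[.

Definition condition_b (mu : probability (R * R * R)%type R) : Prop :=
  (mu (lo `*` lo `*` lo) = (1/4)%:E /\ mu (lo `*` hi `*` hi) = (1/4)%:E /\
   mu (hi `*` hi `*` lo) = (1/4)%:E /\ mu (hi `*` lo `*` hi) = (1/4)%:E) \/
  (mu (lo `*` lo `*` hi) = (1/4)%:E /\ mu (lo `*` hi `*` lo) = (1/4)%:E /\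
   mu (hi `*` hi `*` hi) = (1/4)%:E /\ mu (hi `*` lo `*` lo) = (1/4)%:E).

End CopulaDefs.

(* Main.v *)
(** Since the bivariate margins (1,3) and (2,3) are independent, F13(t,u) = u and
    F23(t,u) = u for almost every t, whence psi(C)(a,b,v) = v C(a,b,1).  Let p and q
    be the masses of [0,a] x [0,b] below and above level v.  Then
    C(a,b,v) - psi(C)(a,b,v) = (1-v) p - v q, and the Frechet bounds
    (a+b-1)^+ v <= p <= min(a,b) v and (a+b-1)^+ (1-v) <= q <= min(a,b) (1-v) give
    |C - psi(C)| <= v (1-v) min(a,b,1-a,1-b) <= 1/8.  Near-equality forces (a,b,v) to be
    near (1/2,1/2,1/2); as copulas are Lipschitz, the supremum is 1/8 iff it is attained
    at that point, where the eight octant masses are determined by p and q. *)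

Require Import Defs.
From mathcomp Require Import all_boot all_order all_algebra.
From mathcomp Require Import all_classical all_reals all_analysis.
From mathcomp Require Import measurable_realfun ring lra.
Import Order.TTheory GRing.Theory Num.Theory.
Import numFieldNormedType.Exports.
Local Open Scope ring_scope.
Local Open Scope classical_set_scope.

(** * Preliminaries: differentiation of integrals, partitions into cells, absence of atoms *)

(** Lebesgue differentiation: for almost every t the derivative of the integral over [0,v] at v = t
    is f(t), while the hypothesis makes it c. The bound M only serves to make f locally
    integrable. *)
Lemma ae_eq_cst_of_integral_itv (R : realType) (f : R -> R) (c M : R) :
  measurable_fun setT f -> (forall t, `|f t| <= M) ->
  (forall v, 0 <= v <= 1 ->
     (\int[lebesgue_measure]_(t in `[0%R, v]) (f t)%:E = (c * v)%:E)%E) ->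
  {ae (@lebesgue_measure R), forall t, I01 t -> f t = c}.
Proof.
move=> mf fM fc.
have intf (A : set R) : measurable A -> (lebesgue_measure A < +oo)%E ->
    lebesgue_measure.-integrable A (EFin \o f).
  move=> mA Afin; apply: measurable_bounded_integrable => //.
    exact: measurable_funTS.
  exists M; split; first exact: num_real.
  by move=> y My x Ax; exact: le_trans (fM _) (ltW My).
have iitv (y : R) : lebesgue_measure.-integrable `[0%R, y] (EFin \o f).
  apply: intf; first exact: measurable_itv.
  exact/compact_finite_measure/segment_compact.
have locf : locally_integrable [set: R] f.
  split=> //; first exact: openT.
  move=> A _ cA; have mA := compact_measurable cA.
  by have /integrableP[_] := intf A mA (compact_finite_measure cA).
(* The endpoints are discarded because the formula for the integral must hold on a two-sided
   neighbourhood of t. *)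
have N0 : {ae (@lebesgue_measure R), forall t, t != 0 /\ t != 1}.
  exists [set 0; 1]; split.
  - exact: measurableU.
  - exact/countable_lebesgue_measure0/finite_set_countable/finite_set2.
  - move=> t /= /not_andP[] /negP; rewrite negbK => /eqP ->; [by left|by right].
have := FTC1 iitv locf.
move: N0; apply: filterS2; first exact: (ae_filter_ringOfSetsType lebesgue_measure).
move=> t [t0 t1] + /[dup] It; rewrite /I01 /= in_itv /= => + /andP[t0' t1'].
have {}t0' : 0 < t by rewrite lt_neqAle eq_sym t0.
have {}t1' : t < 1 by rewrite lt_neqAle t1.
rewrite lte_fin t0' => /(_ isT)[_ <-].
rewrite derive1E (@near_eq_derive _ _ _ _ (fun x : R => c *: x)).
  by rewrite -derive1E derive1Ml // derive1_id mulr1.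
near=> x.
have x0 : 0 <= x <= 1.
  have : x \in `]0%R, 1%R[%R by near: x; apply: near_in_itvoo; rewrite in_itv /= t0'.
  by rewrite in_itv /= => /andP[/ltW -> /ltW ->].
by rewrite /Rintegral fc.
Unshelve. all: by end_near. Qed.

Lemma fine_probability_split {d} {T : measurableType d} {R : realType}
    (P : probability T R) (A B : set T) : measurable A -> measurable B ->
  fine (P A) = fine (P (A `&` B)) + fine (P (A `&` ~` B)).
Proof.
move=> mA mB; have mAB := measurableI A B mA mB.
have mAB' : measurable (A `&` ~` B) by apply: measurableI => //; exact: measurableC.
rewrite -fineD ?fin_num_measure// -measureU//.
- by rewrite -setIUr setUv setIT.
- by rewrite setIACA setICr setI0.
Qed.

(** Every later exchange of a box for sublevel sets, or of an open half-cube for an octant, is made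
    off a null set N. *)
Lemma probability_eq_mod_null {d} {T : measurableType d} {R : realType}
    (P : probability T R) (N A B : set T) :
    measurable N -> P N = 0%E -> measurable A -> measurable B ->
    (forall x, ~ N x -> A x <-> B x) ->
  P A = P B.
Proof.
move=> mN N0 mA mB AB.
suff E C : measurable C -> P C = P (C `&` ~` N).
  rewrite (E A)// (E B)//; congr (P _); apply/seteqP.
  by split=> x /= [Cx Nx]; split=> //; apply/AB.
move=> mC; rewrite -setDE measureD// ?(subset_measure0 _ _ (@subIsetr _ C N))//.
- by rewrite sube0.
- exact: measurableI.
- by rewrite -ge0_fin_numE ?fin_num_measure.
Qed.

(** These are the eight atoms of the algebra generated by A, B, C; [true] selects the event, [false]
    its complement. *)
Definition cell {d} {T : measurableType d} {R : realType}
    (P : probability T R) (A B C : set T) (i j k : bool) : R :=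
  fine (P ((if i then A else ~` A) `&` (if j then B else ~` B)
           `&` (if k then C else ~` C))).

Lemma cell_ge0 {d} {T : measurableType d} {R : realType}
    (P : probability T R) (A B C : set T) i j k : 0 <= cell P A B C i j k.
Proof. exact: fine_ge0. Qed.

(** Additivity, one event at a time, turns statements on probabilities into linear equations in
    eight unknowns. *)
Lemma cell_sums {d} {T : measurableType d} {R : realType}
    (P : probability T R) (A B C : set T) (c := cell P A B C) :
    measurable A -> measurable B -> measurable C ->
  [/\ c true true true + c true false true = fine (P (A `&` C)),
      c true true true + c false true true = fine (P (B `&` C)),
      c true true true + c true true false = fine (P (A `&` B)),
      c true true true + c true true false
        + (c true false true + c true false false) = fine (P A) &
  [/\ c true true true + c true true false
        + (c false true true + c false true false) = fine (P B),
      c true true true + c true false true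
        + (c false true true + c false false true) = fine (P C) &
      c true true true + c true true false
        + (c true false true + c true false false)
        + (c false true true + c false true false
        + (c false false true + c false false false)) = 1]].
Proof.
move=> mA mB mC.
have mA' := measurableC mA; have mB' := measurableC mB.
pose S (A : set T) (i : bool) := if i then A else ~` A.
have mS D i : measurable D -> measurable (S D i).
  by move=> mD; case: i => //; exact: measurableC.
have AC i k : c i true k + c i false k = fine (P (S A i `&` S C k)).
  rewrite (fine_probability_split P _ B)//; last by apply: measurableI; exact: mS.
  by rewrite /c /cell /S setIAC [X in _ = _ + fine (P X)]setIAC.
have BC j k : c true j k + c false j k = fine (P (S B j `&` S C k)).
  rewrite (fine_probability_split P _ A)//; last by apply: measurableI; exact: mS.
  by rewrite /c /cell /S [X in _ = fine (P X) + _]setIC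
    [X in _ = _ + fine (P X)]setIC !setIA.
have AB i j : c i j true + c i j false = fine (P (S A i `&` S B j)).
  rewrite (fine_probability_split P _ C)//; by apply: measurableI; exact: mS.
have P1 : 1 = fine (P setT) by rewrite probability_setT.
have PA i : c i true true + c i true false + (c i false true + c i false false)
    = fine (P (S A i)).
  by rewrite !AB (fine_probability_split P (S A i) B)//; exact: mS.
split; [exact: (AC true true)|exact: (BC true true)|exact: (AB true true)
       |exact: (PA true)|split].
- rewrite (AB true true) (AB false true) (fine_probability_split P B A)//.
  by rewrite [B `&` A]setIC [B `&` ~` A]setIC.
- rewrite (AC true true) (AC false true) (fine_probability_split P C A)//.
  by rewrite [C `&` A]setIC [C `&` ~` A]setIC.
- by rewrite (PA true) (PA false) P1 (fine_probability_split P setT A)// !setTI.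
Qed.

(* a uniform variable has no atoms: [{f = c}] is contained in
   [{f <= c} \ {f <= c - e}], of measure at most [e] *)
Lemma uniform_no_atom {d} {T : measurableType d} {R : realType}
    (P : probability T R) (f : T -> R) :
    measurable_fun setT f ->
    (forall a, 0 <= a <= 1 -> P [set x | f x <= a] = a%:E) ->
  forall c, 0 <= c <= 1 -> P [set x | f x = c] = 0%E.
Proof.
move=> mf fU c c01.
have mle a : measurable [set x | f x <= a].
  rewrite -[X in measurable X]setTI.
  by have := mf measurableT _ (measurable_itv `]-oo, a]%R); congr (measurable (_ `&` _));
    apply/seteqP; split=> x /=; rewrite in_itv.
have meq : measurable [set x | f x = c].
  by rewrite -[X in measurable X]setTI; exact: mf measurableT _ (measurable_set1 c).
(* At c = 0 there is no smaller level in [0,1], but {f <= 0} itself is null. *)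
have [c0|c0] := eqVneq c 0; first rewrite c0 in meq *.
  apply/eqP; rewrite -measure_le0.
  apply: (@le_trans _ _ (P [set x | f x <= 0])); last by rewrite fU// lexx ler01.
  by apply: le_measure; rewrite ?inE//= => x /= ->.
apply/eqP; rewrite -measure_le0; apply/lee_addgt0Pr => e e0; rewrite add0e.
(* Truncation at 0 keeps the level where the distribution is known; the mass c - a is still at most
   e. *)
pose a := Num.max 0 (c - e).
have a01 : 0 <= a <= 1 by rewrite /a le_max lexx /= ge_max ler01 /=; lra.
have ac : a < c by rewrite /a gt_max lt_neqAle eq_sym c0 /=; lra.
have := fine_probability_split P [set x | f x <= c] [set x | f x <= a] (mle c) (mle a).
have -> : [set x | f x <= c] `&` [set x | f x <= a] = [set x | f x <= a].
  by apply/seteqP; split=> [x /= []//|x /= fa]; split=> //; lra.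
rewrite !fU//= => /esym E.
have mD : measurable ([set x | f x <= c] `&` ~` [set x | f x <= a]).
  by apply: measurableI => //; exact: measurableC.
apply: (@le_trans _ _ (P ([set x | f x <= c] `&` ~` [set x | f x <= a]))).
  by apply: le_measure; rewrite ?inE// => x /= ->; split=> //; lra.
rewrite -[leLHS]fineK ?fin_num_measure// lee_fin.
have : c - e <= a by rewrite /a le_max lexx orbT.
lra.
Qed.

Lemma measurable_set_le {d} {T : measurableType d} {R : realType}
    (f g : T -> R) : measurable_fun setT f -> measurable_fun setT g ->
  measurable [set x | f x <= g x].
Proof.
move=> mf mg; rewrite -[X in measurable X]setTI.
exact: measurable_fun_le.
Qed.

(** * Conditional margins under independence and a closed form for the partial vine copula *)

Lemma pkernel_le1 {R : realType} (K : R.-pker R ~> (R * R)%type)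
    (A : set (R * R)) t : measurable A -> (K t A <= 1)%E.
Proof.
move=> mA; rewrite -(prob_kernel (s := K) t).
by apply: le_measure; rewrite ?inE.
Qed.

Lemma pkernel_fin_num {R : realType} (K : R.-pker R ~> (R * R)%type)
    (A : set (R * R)) t : measurable A -> K t A \is a fin_num.
Proof.
move=> mA; rewrite ge0_fin_numE//.
exact: le_lt_trans (pkernel_le1 K A t mA) (ltry 1).
Qed.

Lemma kernel_fine_ge0_le1 {R : realType} (K : R.-pker R ~> (R * R)%type)
    (A : set (R * R)) t : measurable A -> 0 <= fine (K t A) <= 1.
Proof.
move=> mA; rewrite fine_ge0//= -lee_fin fineK ?pkernel_fin_num//.
exact: pkernel_le1.
Qed.

Lemma measurable_fine_kernel {R : realType} (K : R.-pker R ~> (R * R)%type)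
    (A : set (R * R)) : measurable A -> measurable_fun setT (fun t => fine (K t A)).
Proof.
move=> mA; apply/measurable_EFinP.
rewrite (_ : _ \o _ = K ^~ A); first exact: measurable_kernel.
by apply/funext => t /=; rewrite fineK ?pkernel_fin_num.
Qed.

Lemma setI_itv_I01 {R : realType} (v : R) : 0 <= v <= 1 ->
  `[0%R, v] `&` I01 = `[0%R, v] :> set R.
Proof.
move=> v01; apply/seteqP; split=> x /=; rewrite /I01/= !in_itv/=; lra.
Qed.

(** By disintegration K(t,A) has integral u v over every [0,v], so differentiation applies; kernel
    values in [0,1] give the bound 1. *)
Lemma rcd_ae_cst {R : realType} (mu : probability (R * R * R)%type R)
    (K : R.-pker R ~> (R * R)%type) (A : set (R * R)) (u : R) :
    is_rcd mu K -> measurable A ->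
    (forall v, 0 <= v <= 1 -> fine (mu (A `*` `[0%R, v])) = u * v) ->
  {ae (@lebesgue_measure R), forall t, I01 t -> fine (K t A) = u}.
Proof.
move=> rcd mA Av; apply: (@ae_eq_cst_of_integral_itv _ _ _ 1).
- exact: measurable_fine_kernel.
- move=> t; have := kernel_fine_ge0_le1 K A t mA.
  by rewrite ler_norml => /andP[? ->]; rewrite andbT; lra.
- move=> v v01; have mv : measurable (`[0%R, v] : set R) by exact: measurable_itv.
  rewrite -Av// fineK ?fin_num_measure//; last exact: measurableX.
  rewrite rcd// setI_itv_I01//; apply: eq_integral => t _.
  by rewrite fineK ?pkernel_fin_num.
Qed.

(** This is where C_13 = Pi enters. The exceptional null set may depend on u, which is harmless
    since psi is evaluated at fixed arguments. *)
Lemma F13_ae {R : realType} (mu : probability (R * R * R)%type R)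
    (K : R.-pker R ~> (R * R)%type) (u : R) :
    in_F3Pi mu -> is_rcd mu K -> 0 <= u <= 1 ->
  {ae (@lebesgue_measure R), forall t, I01 t -> F13 K t u = u}.
Proof.
move=> [_ [C13 _]] rcd u01; apply: rcd_ae_cst rcd _ _.
  by apply: measurableX; exact: measurable_itv.
by move=> v v01; exact: C13.
Qed.

Lemma F23_ae {R : realType} (mu : probability (R * R * R)%type R)
    (K : R.-pker R ~> (R * R)%type) (u : R) :
    in_F3Pi mu -> is_rcd mu K -> 0 <= u <= 1 ->
  {ae (@lebesgue_measure R), forall t, I01 t -> F23 K t u = u}.
Proof.
move=> [_ [_ C23]] rcd u01; apply: rcd_ae_cst rcd _ _.
  by apply: measurableX; exact: measurable_itv.
by move=> v v01; exact: C23.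
Qed.

(** For almost every t the conditional margins at s1, s2 are s1, s2 themselves, so the conditional
    copula there is the kernel mass of [0,s1] x [0,s2], and integrating over t recovers the
    (1,2)-margin of C. *)
Lemma partial_copulaE {R : realType} (mu : probability (R * R * R)%type R)
    (K : R.-pker R ~> (R * R)%type) (Ct : R -> R -> R -> R) (s1 s2 : R) :
    in_F3Pi mu -> is_rcd mu K -> is_cond_copulas K Ct ->
    measurable_fun I01 (fun t => Ct t s1 s2) ->
    0 <= s1 <= 1 -> 0 <= s2 <= 1 ->
  partial_copula Ct s1 s2 = copula3_fun mu s1 s2 1.
Proof.
move=> Cmu rcd cond mCt s1I s2I.
have mA : measurable (`[0%R, s1] `*` `[0%R, s2] : set (R * R)).
  by apply: measurableX; exact: measurable_itv.
have mI : measurable (`[0%R, 1%R] : set R) by exact: measurable_itv.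
rewrite /partial_copula /copula3_fun rcd// setI_itv_I01 ?lexx ?ler01//.
congr fine; apply: ae_eq_integral => //.
- exact/measurable_EFinP.
- by apply: measurable_funTS; exact: (measurable_kernel K _ mA).
- have aeF := ae_filter_ringOfSetsType (@lebesgue_measure R).
  move: cond (F13_ae _ _ _ Cmu rcd s1I) (F23_ae _ _ _ Cmu rcd s2I).
  apply: filterS3 => t Kt F1 F2 It.
  by have [_ ->//] := Kt It; rewrite F1// F2.
Qed.

(** Needed because psi composes the partial copula with functions of t. The boxes are the sections
    of one measurable set [A] of pairs (corner, point), and the measure of a section is measurable
    in the corner. *)
Lemma measurable_copula3_fun12 {R : realType} (mu : probability (R * R * R)%type R) v :
  measurable_fun setT (fun s : R * R => copula3_fun mu s.1 s.2 v).
Proof.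
pose A := [set z : (R * R) * (R * R * R) |
  (0 <= z.2.1.1 /\ z.2.1.1 <= z.1.1) /\ (0 <= z.2.1.2 /\ z.2.1.2 <= z.1.2)
  /\ (0 <= z.2.2 /\ z.2.2 <= v)].
have mA : measurable A.
  by repeat apply: measurableI; apply: measurable_set_le => //;
    repeat apply: measurableT_comp => //.
apply: measurableT_comp => //.
have -> : (fun s : R * R => mu (`[0, s.1] `*` `[0, s.2] `*` `[0, v])) = mu \o xsection A.
  apply/funext => s /=; congr (mu _); apply/seteqP; split=> x; rewrite /xsection /=.
    rewrite !in_itv/= inE /A/= => -[[/andP[? ?] /andP[? ?]] /andP[? ?]]. by [].
  rewrite !in_itv/= inE /A/= => -[[-> ->] [[-> ->] [-> ->]]]. by [].
exact: measurable_fun_xsection.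
Qed.

Lemma psiE {R : realType} (mu : probability (R * R * R)%type R)
    (K : R.-pker R ~> (R * R)%type) (Ct : R -> R -> R -> R) (u1 u2 v : R) :
    in_F3Pi mu -> is_rcd mu K -> is_cond_copulas K Ct ->
    (forall s1 s2, measurable_fun I01 (fun t => Ct t s1 s2)) ->
    0 <= u1 <= 1 -> 0 <= u2 <= 1 -> 0 <= v <= 1 ->
  psi K Ct u1 u2 v = v * copula3_fun mu u1 u2 1.
Proof.
move=> Cmu rcd cond mCt u1I u2I v01.
have v0 : 0 <= v by case/andP: v01.
have mI : measurable (`[0%R, v] : set R) by exact: measurable_itv.
have mbox (a b : R) : measurable (`[0%R, a] `*` `[0%R, b] : set (R * R)).
  by apply: measurableX; exact: measurable_itv.
pose g t := copula3_fun mu (F13 K t u1) (F23 K t u2) 1.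
have mg : measurable_fun setT g.
  apply: (measurableT_comp (measurable_copula3_fun12 mu 1)
    (_ : measurable_fun setT (fun t => (F13 K t u1, F23 K t u2)))).
  by apply: measurable_fun_pair; apply: measurable_fine_kernel; exact: mbox.
transitivity (fine (\int[lebesgue_measure]_(t in `[0%R, v]) (copula3_fun mu u1 u2 1)%:E)%E).
  (* Replacing the partial copula by the margin is valid for every t, as kernel values lie in [0,1];
     only replacing the conditional margins by u1, u2 is almost everywhere. *)
  congr fine; transitivity (\int[lebesgue_measure]_(t in `[0%R, v]) (g t)%:E)%E.
    apply: eq_integral => t _; congr (_%:E).
    by apply: (@partial_copulaE _ mu K) => //; apply: kernel_fine_ge0_le1; exact: mbox.
  apply: ae_eq_integral => //.
  - by apply/measurable_EFinP; exact: measurable_funTS.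
  - have aeF := ae_filter_ringOfSetsType (@lebesgue_measure R).
    move: (F13_ae _ _ _ Cmu rcd u1I) (F23_ae _ _ _ Cmu rcd u2I).
    apply: filterS2 => t F1 F2 It.
    have {}It : I01 t by move: It; rewrite -(setI_itv_I01 v v01) => -[].
    by rewrite /g F1// F2.
rewrite integral_cst//= lebesgue_measure_itv/= lte_fin.
(* The length of an interval is given by cases; the degenerate one is v = 0. *)
case: ifPn => [_|]; first by rewrite -EFinB -EFinM/= subr0 mulrC.
rewrite -leNgt => v0'; have -> : v = 0 by apply/eqP; rewrite eq_le v0' v0.
by rewrite mule0 mul0r.
Qed.

(** * Copula values as masses of sublevel sets *)

(** Unlike the boxes [0,a] x I x I, sublevel sets treat the three coordinates alike and have simple
    complements; inside the cube both agree. *)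
Definition lev {T : Type} {R : realType} (f : T -> R) (a : R) : set T :=
  [set x | f x <= a].

Lemma measurable_lev {d} {T : measurableType d} {R : realType}
    (f : T -> R) (a : R) : measurable_fun setT f -> measurable (lev f a).
Proof. by move=> mf; exact: measurable_set_le. Qed.

Lemma measurable_coord1 (R : realType) : measurable_fun setT (fun x : R * R * R => x.1.1).
Proof. by do 2 apply: measurableT_comp => //. Qed.

Lemma measurable_coord2 (R : realType) : measurable_fun setT (fun x : R * R * R => x.1.2).
Proof. by do 2 apply: measurableT_comp => //. Qed.

Lemma measurable_coord3 (R : realType) : measurable_fun setT (fun x : R * R * R => x.2).
Proof. exact: measurable_snd. Qed.

(** For a <= a' the two masses differ by that of a subset of {a < f <= a'}, which has mass a' -
    a. *)
Lemma lev_lipschitz {d} {T : measurableType d} {R : realType}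
    (P : probability T R) (f : T -> R) (B : set T) :
    measurable_fun setT f ->
    (forall a, 0 <= a <= 1 -> P (lev f a) = a%:E) -> measurable B ->
  forall a a', 0 <= a <= 1 -> 0 <= a' <= 1 ->
  `|fine (P (lev f a `&` B)) - fine (P (lev f a' `&` B))| <= `|a - a'|.
Proof.
move=> mf fU mB a a'; wlog aa' : a a' / a <= a' => [wh aI a'I|aI a'I].
  have [aa'|/ltW a'a] := leP a a'; first exact: wh.
  by rewrite distrC [leRHS]distrC; exact: wh.
have ml b := measurable_lev f b mf.
have mC : measurable (~` lev f a) by exact: measurableC.
have sub : lev f a `<=` lev f a' by move=> x /= fxa; exact: le_trans fxa aa'.
have := fine_probability_split P _ _ (measurableI _ _ (ml a') mB) (ml a).
rewrite setIAC (setIidr sub) => ->.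
have := fine_probability_split P _ _ (ml a') (ml a).
rewrite (setIidr sub) !fU//= => E.
have : fine (P (lev f a' `&` B `&` ~` lev f a)) <= fine (P (lev f a' `&` ~` lev f a)).
  have m1 : measurable (lev f a' `&` ~` lev f a) by exact: measurableI.
  have m2 : measurable (lev f a' `&` B `&` ~` lev f a).
    by apply: measurableI => //; exact: measurableI.
  apply: fine_le; rewrite ?fin_num_measure//.
  by apply: le_measure; rewrite ?inE// => x /= [[]].
have : 0 <= fine (P (lev f a' `&` B `&` ~` lev f a)) by exact: fine_ge0.
rewrite opprD addNKr normrN => h0 h1.
rewrite ger0_norm// distrC ger0_norm; lra.
Qed.

Lemma measurable_box {R : realType} (i j k : interval R) :
  measurable ([set` i] `*` [set` j] `*` [set` k]).
Proof. by do 2 (apply: measurableX; last exact: measurable_itv); exact: measurable_itv. Qed.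

Lemma copula3_eq_mod_cube {R : realType} (mu : probability (R * R * R)%type R)
    (A B : set (R * R * R)) :
    is_copula3_measure mu -> measurable A -> measurable B ->
    (forall x, (I01 `*` I01 `*` I01) x -> A x <-> B x) ->
  mu A = mu B.
Proof.
move=> [mu1 _] mA mB AB.
have mI : measurable (I01 `*` I01 `*` I01 : set (R * R * R)) by exact: measurable_box.
apply: (@probability_eq_mod_null _ _ _ mu (~` (I01 `*` I01 `*` I01))) => //.
- exact: measurableC.
- by rewrite probability_setC// mu1 subee.
- by move=> x /contrapT; exact: AB.
Qed.

Lemma copula3_margins {R : realType} (mu : probability (R * R * R)%type R) a :
    is_copula3_measure mu -> 0 <= a <= 1 ->
  [/\ mu (lev (fun x => x.1.1) a) = a%:E, mu (lev (fun x => x.1.2) a) = a%:E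
    & mu (lev (fun x => x.2) a) = a%:E].
Proof.
move=> Cmu aI; have [_ [m1 [m2 m3]]] := Cmu.
have solve f (B : set (R * R * R)) : measurable_fun setT f -> measurable B ->
    (forall x, (I01 `*` I01 `*` I01) x -> lev f a x <-> B x) -> mu B = a%:E ->
    mu (lev f a) = a%:E.
  move=> mf mB fB <-; apply: (copula3_eq_mod_cube mu _ _ Cmu) => //.
  exact: measurable_lev.
split; [apply: solve (m1 a aI)|apply: solve (m2 a aI)|apply: solve (m3 a aI)];
  do ?[exact: measurable_box|exact: measurable_coord1|exact: measurable_coord2
      |exact: measurable_coord3];
  move=> -[[x y] z]; rewrite /I01 /lev /= !in_itv/= => -[[? ?] ?]; lra.
Qed.

Lemma copula3_funE {R : realType} (mu : probability (R * R * R)%type R) a b v :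
    is_copula3_measure mu ->
  copula3_fun mu a b v = fine (mu (lev (fun x => x.1.1) a
    `&` lev (fun x => x.1.2) b `&` lev (fun x => x.2) v)).
Proof.
move=> Cmu; congr fine; apply: (copula3_eq_mod_cube mu _ _ Cmu).
- exact: measurable_box.
- by do 2? apply: measurableI; apply: measurable_lev;
    first [exact: measurable_coord1|exact: measurable_coord2|exact: measurable_coord3].
- move=> -[[x y] z]; rewrite /I01 /lev /= !in_itv/= => -[[? ?] ?]; lra.
Qed.

(** * Octant masses and the pointwise bound on C - psi(C) *)

(** In each coordinate [true] means at or below the level and [false] strictly above it. *)
Definition octant {R : realType} (mu : probability (R * R * R)%type R) (a b v : R)
    : bool -> bool -> bool -> R :=
  cell mu (lev (fun x => x.1.1) a) (lev (fun x => x.1.2) b) (lev (fun x => x.2) v).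

(** Together with nonnegativity, this linear system is all that the pointwise bound uses; the
    products a v and b v come from the two independent margins. *)
Lemma octant_sums {R : realType} (mu : probability (R * R * R)%type R) (a b v : R)
    (c := octant mu a b v) :
    in_F3Pi mu -> 0 <= a <= 1 -> 0 <= b <= 1 -> 0 <= v <= 1 ->
  [/\ copula3_fun mu a b v = c true true true,
      copula3_fun mu a b 1 = c true true true + c true true false,
      c true true true + c true false true = a * v,
      c true true true + c false true true = b * v &
  [/\ c true true true + c true true false
        + (c true false true + c true false false) = a,
      c true true true + c true true false
        + (c false true true + c false true false) = b,
      c true true true + c true false true
        + (c false true true + c false false true) = v &
      c true true true + c true true false
        + (c true false true + c true false false)
        + (c false true true + c false true false
        + (c false false true + c false false false)) = 1]].
Proof.
move=> [Cmu [C13 C23]] aI bI vI.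
have m1 := measurable_lev (fun x : R * R * R => x.1.1) a (measurable_coord1 R).
have m2 := measurable_lev (fun x : R * R * R => x.1.2) b (measurable_coord2 R).
have m3 := measurable_lev (fun x : R * R * R => x.2) v (measurable_coord3 R).
have [E1 _ _] := copula3_margins mu a Cmu aI.
have [_ E2 _] := copula3_margins mu b Cmu bI.
have [_ _ E3] := copula3_margins mu v Cmu vI.
have [sAC sBC sAB sA [sB sC s1]] := cell_sums mu _ _ _ m1 m2 m3.
have lev1 (x : R * R * R) : (I01 `*` I01 `*` I01) x -> [/\ x.1.1 <= 1, x.1.2 <= 1 & x.2 <= 1].
  by case: x => -[x y] z; rewrite /I01 /= !in_itv/= => -[[/andP[_ ->] /andP[_ ->]] /andP[_ ->]].
have n1 := measurable_lev (fun x : R * R * R => x.1.1) 1 (measurable_coord1 R).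
have n2 := measurable_lev (fun x : R * R * R => x.1.2) 1 (measurable_coord2 R).
have n3 := measurable_lev (fun x : R * R * R => x.2) 1 (measurable_coord3 R).
split.
- exact: copula3_funE.
- rewrite /c sAB copula3_funE//; congr fine.
  apply: (copula3_eq_mod_cube mu _ _ Cmu); do ?[by []|apply: measurableI].
  by move=> x /lev1[x1 y1 z1]; split => [[[]]|[]] //.
- rewrite /c sAC -C13// copula3_funE//; congr fine.
  apply: (copula3_eq_mod_cube mu _ _ Cmu); do ?[by []|apply: measurableI].
  by move=> x /lev1[x1 y1 z1]; split => [[? ?]|[[? ?] ?]] //; split.
- rewrite /c sBC -C23// copula3_funE//; congr fine.
  apply: (copula3_eq_mod_cube mu _ _ Cmu); do ?[by []|apply: measurableI].
  by move=> x /lev1[x1 y1 z1]; split => [[? ?]|[[? ?] ?]] //; split.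
- by split => //; [rewrite /c sA E1|rewrite /c sB E2|rewrite /c sC E3].
Qed.

(** By [psiE] this is C - psi(C) on the unit cube, freed of the kernel and the conditional
    copulas. *)
Definition gap {R : realType} (mu : probability (R * R * R)%type R) (a b v : R) : R :=
  copula3_fun mu a b v - v * copula3_fun mu a b 1.

(** Four separate bounds stand for min(a, b, 1-a, 1-b), so that only linear arithmetic is needed
    later. *)
Lemma gap_le {R : realType} (mu : probability (R * R * R)%type R) (a b v : R) :
    in_F3Pi mu -> 0 <= a <= 1 -> 0 <= b <= 1 -> 0 <= v <= 1 ->
  [/\ `|gap mu a b v| <= v * (1 - v) * a, `|gap mu a b v| <= v * (1 - v) * (1 - a),
      `|gap mu a b v| <= v * (1 - v) * b & `|gap mu a b v| <= v * (1 - v) * (1 - b)].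
Proof.
move=> Cmu aI bI vI; rewrite /gap.
have [-> -> s1 s2 [s3 s4 s5 s6]] := octant_sums mu a b v Cmu aI bI vI.
have c0 i j k : 0 <= octant mu a b v i j k by exact: cell_ge0.
move: (c0 true true true) (c0 true true false) (c0 true false true)
  (c0 true false false) (c0 false true true) (c0 false true false)
  (c0 false false true) (c0 false false false) s1 s2 s3 s4 s5 s6.
clear c0.
(* The masses become real variables: p and q lie over [0,a] x [0,b], below and above v. *)
move: (octant _ _ _ _ _ _ _) => p.
move: (octant _ _ _ _ _ _ _) => q.
move: (octant _ _ _ _ _ _ _) => c101.
move: (octant _ _ _ _ _ _ _) => c100.
move: (octant _ _ _ _ _ _ _) => c011.
move: (octant _ _ _ _ _ _ _) => c010.
move: (octant _ _ _ _ _ _ _) => c001.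
move: (octant _ _ _ _ _ _ _) => c000.
case/andP: aI => a0 a1; case/andP: bI => b0 b1; case/andP: vI => v0 v1.
move=> h1 h2 h3 h4 h5 h6 h7 h8 s1 s2 s3 s4 s5 s6.
have w0 : 0 <= 1 - v by lra.
(* The difference is (1-v) x - v y: an upper bound on one mass and a lower bound on the other leave
   v (1-v) (M-m). Below, M is a or b and m is 0 or a+b-1. *)
have bnd x y m M : x <= (M * v) -> m * (1 - v) <= y -> x - v * (x + y) <= v * (1 - v) * (M - m).
  move=> hx hy; have := ler_wpM2l w0 hx; have := ler_wpM2l v0 hy; lra.
have bnd' x y m M : m * v <= x -> y <= M * (1 - v) -> - (v * (1 - v) * (M - m)) <= x - v * (x + y).
  move=> hx hy; have := ler_wpM2l w0 hx; have := ler_wpM2l v0 hy; lra.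
(* Lower Frechet bounds: inclusion-exclusion within each slab, dropping [c001] and [c000]
   respectively. *)
have pl : (a + b - 1) * v <= p by lra.
have ql : (a + b - 1) * (1 - v) <= q by lra.
have := bnd p q 0 a; have := bnd p q 0 b; have := bnd' p q 0 a; have := bnd' p q 0 b.
have := bnd p q (a + b - 1) a; have := bnd p q (a + b - 1) b.
have := bnd' p q (a + b - 1) a; have := bnd' p q (a + b - 1) b.
rewrite !subr0 !mul0r.
have -> : b - (a + b - 1) = 1 - a by ring.
have -> : a - (a + b - 1) = 1 - b by ring.
have pa : p <= a * v by lra.
have pb : p <= b * v by lra.
have qa : q <= a * (1 - v) by lra.
have qb : q <= b * (1 - v) by lra.
move=> /(_ pl qb) k1 /(_ pl qa) k2 /(_ pb ql) k3 /(_ pa ql) k4.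
move=> /(_ h1 qb) k5 /(_ h1 qa) k6 /(_ pb h2) k7 /(_ pa h2) k8.
by split; rewrite ler_norml ?k1 ?k2 ?k3 ?k4 ?k5 ?k6 ?k7 ?k8.
Qed.

(** * The octants at the centre of the cube and condition (b) *)

Lemma null_setU {d} {T : measurableType d} {R : realType}
    (P : probability T R) (A B : set T) :
  measurable A -> measurable B -> P A = 0%E -> P B = 0%E -> P (A `|` B) = 0%E.
Proof.
move=> mA mB A0 B0; apply/eqP; rewrite -measure_le0.
by apply: le_trans (measureU2 _ mA mB) _ => /=; rewrite A0 B0 adde0.
Qed.

(** Within [0,1], only at these values do [lo] and [hi] differ from t <= 1/2 and t > 1/2. *)
Definition endpoints {T : Type} {R : realType} (f : T -> R) : set T :=
  [set x | f x = 0] `|` [set x | f x = 1/2] `|` [set x | f x = 1].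

Lemma endpoints_null {d} {T : measurableType d} {R : realType}
    (P : probability T R) (f : T -> R) :
    measurable_fun setT f -> (forall a, 0 <= a <= 1 -> P (lev f a) = a%:E) ->
  measurable (endpoints f) /\ P (endpoints f) = 0%E.
Proof.
move=> mf fU.
have m c : measurable [set x | f x = c].
  by rewrite -[X in measurable X]setTI; exact: mf measurableT _ (measurable_set1 c).
have n c : 0 <= c <= 1 -> P [set x | f x = c] = 0%E by exact: uniform_no_atom.
split; first by do 2 (apply: measurableU => //).
apply: null_setU; rewrite ?n ?lexx ?ler01//; first exact: measurableU.
apply: null_setU => //; apply: n; lra.
Qed.

Definition side {R : realType} (i : bool) : set R := if i then lo else hi.

(** Uniform margins have no atoms, so the open half-cubes and the octants differ only on a null set:
    the outside of the cube and the planes through [endpoints]. *)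
Lemma octant_half {R : realType} (mu : probability (R * R * R)%type R) i j k :
    is_copula3_measure mu ->
  mu (side i `*` side j `*` side k) = (octant mu (1/2) (1/2) (1/2) i j k)%:E.
Proof.
move=> Cmu; have ml b : measurable (side b : set R).
  by case: b; exact: measurable_itv.
have [m1 n1] := endpoints_null mu _ (measurable_coord1 R)
  (fun a aI => let: And3 h _ _ := copula3_margins mu a Cmu aI in h).
have [m2 n2] := endpoints_null mu _ (measurable_coord2 R)
  (fun a aI => let: And3 _ h _ := copula3_margins mu a Cmu aI in h).
have [m3 n3] := endpoints_null mu _ (measurable_coord3 R)
  (fun a aI => let: And3 _ _ h := copula3_margins mu a Cmu aI in h).
have mI : measurable (~` (I01 `*` I01 `*` I01) : set (R * R * R)).
  by apply: measurableC; exact: measurable_box.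
have I0 : mu (~` (I01 `*` I01 `*` I01)) = 0%E.
  by rewrite probability_setC ?Cmu.1 ?subee//; exact: measurable_box.
have mS (f : R * R * R -> R) b : measurable_fun setT f ->
    measurable (if b then lev f (1/2) else ~` lev f (1/2) : set (R * R * R)).
  by move=> mf; case: b => //; [|apply: measurableC]; exact: measurable_lev.
have mS1 := mS _ i (measurable_coord1 R).
have mS2 := mS _ j (measurable_coord2 R).
have mS3 := mS _ k (measurable_coord3 R).
have mB : measurable (side i `*` side j `*` side k : set (R * R * R)).
  by do 2 (apply: measurableX => //).
have mO := measurableI _ _ (measurableI _ _ mS1 mS2) mS3.
rewrite /octant /cell fineK ?fin_num_measure//.
have m23 := measurableU _ _ m2 m3.
have n23 := null_setU mu _ _ m2 m3 n2 n3.
have m123 := measurableU _ _ m1 m23.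
have n123 := null_setU mu _ _ m1 m23 n1 n23.
apply: (probability_eq_mod_null mu _ _ _ (measurableU _ _ mI m123)
  (null_setU mu _ _ mI m123 I0 n123)) => //.
move=> [[x y] z] /= /not_orP[/contrapT xI /not_orP[x1 /not_orP[y1 z1]]].
have sideE (b : bool) (t : R) : I01 t -> ~ ((t = 0 \/ t = 1/2) \/ t = 1) ->
    side b t <-> (if b then is_true (t <= 1/2) else ~ (t <= 1/2)).
  rewrite /I01/= in_itv/= => /andP[t0 t1] tn.
  have {}t0 : 0 < t by rewrite lt_neqAle t0 andbT; apply/eqP => t0'; apply: tn; left; left.
  have {}t1 : t < 1 by rewrite lt_neqAle t1 andbT; apply/eqP => t1'; apply: tn; right.
  have th : t != 1/2 by apply/eqP => t1'; apply: tn; left; right.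
  case: b; rewrite /side /lo /hi /= in_itv /=.
    by rewrite t0 /= lt_neqAle th.
  by rewrite t1 andbT; split=> [|/negP]; rewrite ltNge// => /negP.
have {}sideE b t := sideE b t.
have [[Ix Iy] Iz] := xI.
have := sideE i x Ix x1; have := sideE j y Iy y1; have := sideE k z Iz z1.
by case: i {mS1 mB mO}; case: j {mS2}; case: k {mS3} => /=; rewrite /lev /=; tauto.
Qed.

(** At the centre the gap is (p - q)/2 with p and q in [0,1/4]. The value 1/8 in modulus forces one
    of them to be 1/4 and the other 0, and the linear system then fixes the other six masses. *)
Lemma condition_bP {R : realType} (mu : probability (R * R * R)%type R) :
  in_F3Pi mu -> condition_b mu <-> `|gap mu (1/2) (1/2) (1/2)| = 1/8.
Proof.
move=> Fmu; have hI : 0 <= (1/2 : R) <= 1 by lra.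
have Cmu := Fmu.1.
rewrite /condition_b -[lo]/(side true) -[hi]/(side false) !(octant_half mu _ _ _ Cmu).
rewrite /gap.
have [-> -> s1 s2 [s3 s4 s5 s6]] := octant_sums mu _ _ _ Fmu hI hI hI.
have c0 i j k : 0 <= octant mu (1/2) (1/2) (1/2) i j k by exact: cell_ge0.
move: (c0 true true true) (c0 true true false) (c0 true false true)
  (c0 true false false) (c0 false true true) (c0 false true false)
  (c0 false false true) (c0 false false false) s1 s2 s3 s4 s5 s6.
clear c0.
move: (octant _ _ _ _ true true true) => p.
move: (octant _ _ _ _ true true false) => q.
move: (octant _ _ _ _ true false true) => c101.
move: (octant _ _ _ _ true false false) => c100.
move: (octant _ _ _ _ false true true) => c011.
move: (octant _ _ _ _ false true false) => c010.
move: (octant _ _ _ _ false false true) => c001.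
move: (octant _ _ _ _ false false false) => c000.
move=> h1 h2 h3 h4 h5 h6 h7 h8 s1 s2 s3 s4 s5 s6.
split=> [[|] [[e1] [[e2] [[e3] [e4]]]]|].
- rewrite ger0_norm; lra.
- rewrite ler0_norm; lra.
(* The sign of the gap selects the alternative. *)
- have [g0|g0] := leP 0 (p - 1/2 * (p + q)).
    by rewrite ger0_norm// => E; left; repeat split; congr (_%:E); lra.
  by rewrite ltr0_norm// => E; right; repeat split; congr (_%:E); lra.
Qed.

(** * Lipschitz continuity and stability of near-maximal points *)

(** The coordinates are moved one at a time, each at the cost given by its uniform margin. *)
Lemma copula3_fun_lipschitz {R : realType} (mu : probability (R * R * R)%type R)
    (a b v a' b' v' : R) : is_copula3_measure mu ->
    0 <= a <= 1 -> 0 <= b <= 1 -> 0 <= v <= 1 ->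
    0 <= a' <= 1 -> 0 <= b' <= 1 -> 0 <= v' <= 1 ->
  `|copula3_fun mu a b v - copula3_fun mu a' b' v'| <= `|a - a'| + `|b - b'| + `|v - v'|.
Proof.
move=> Cmu aI bI vI aI' bI' vI'; rewrite !copula3_funE//.
have m1 c := measurable_lev (fun x : R * R * R => x.1.1) c (measurable_coord1 R).
have m2 c := measurable_lev (fun x : R * R * R => x.1.2) c (measurable_coord2 R).
have m3 c := measurable_lev (fun x : R * R * R => x.2) c (measurable_coord3 R).
have l1 := lev_lipschitz mu _ _ (measurable_coord1 R)
  (fun a aI => let: And3 h _ _ := copula3_margins mu a Cmu aI in h)
  (measurableI _ _ (m2 b) (m3 v)) a a' aI aI'.
have l2 := lev_lipschitz mu _ _ (measurable_coord2 R)
  (fun a aI => let: And3 _ h _ := copula3_margins mu a Cmu aI in h)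
  (measurableI _ _ (m1 a') (m3 v)) b b' bI bI'.
have l3 := lev_lipschitz mu _ _ (measurable_coord3 R)
  (fun a aI => let: And3 _ _ h := copula3_margins mu a Cmu aI in h)
  (measurableI _ _ (m1 a') (m2 b')) v v' vI vI'.
rewrite !(setIC (lev (fun x => x.2) _)) in l3.
rewrite !setIA in l1 l2.
rewrite !(setIC (lev (fun x => x.1.2) _) (lev (fun x => x.1.1) _)) in l2.
apply: le_trans (ler_distD (fine (mu (lev (fun x => x.1.1) a'
    `&` lev (fun x => x.1.2) b `&` lev (fun x => x.2) v))) _ _) _.
rewrite -addrA; apply: lerD l1 _.
apply: le_trans (ler_distD (fine (mu (lev (fun x => x.1.1) a'
    `&` lev (fun x => x.1.2) b' `&` lev (fun x => x.2) v))) _ _) _.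
exact: lerD l2 l3.
Qed.

(** A quantitative substitute for compactness: a nearly extremal point is within e of the centre in
    v and within 2e in a and b, so the value at the centre is nearly extremal too. The constant 20
    is generous. *)
Lemma gap_half_ge {R : realType} (mu : probability (R * R * R)%type R) (a b v e : R) :
    in_F3Pi mu -> 0 <= a <= 1 -> 0 <= b <= 1 -> 0 <= v <= 1 -> 0 < e <= 1 ->
    1/8 - e ^+ 2 / 2 < `|gap mu a b v| ->
  1/8 - 20 * e <= `|gap mu (1/2) (1/2) (1/2)|.
Proof.
move=> Fmu aI bI vI /andP[e0 e1] He.
have hI : 0 <= (1/2 : R) <= 1 by lra.
have oI : 0 <= (1 : R) <= 1 by lra.
have [ga ga' gb gb'] := gap_le mu a b v Fmu aI bI vI.
have vv : v * (1 - v) <= 1/4 by have := sqr_ge0 (v - 1/2); rewrite expr2; lra.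
have vv0 : 0 <= v * (1 - v) by apply: mulr_ge0; lra.
(* The mean of the bounds with a and 1-a is v (1-v)/2 = 1/8 - (v - 1/2)^2/2. *)
have ve : `|v - 1/2| <= e.
  rewrite -ler_sqr ?nnegrE ?(ltW e0)// -normrX ger0_norm ?sqr_ge0//.
  by move: He ga ga'; rewrite !expr2; lra.
have e2 : e ^+ 2 <= e by rewrite expr2 ler_piMl// ltW.
have nd (c : R) : 0 <= c <= 1 -> `|gap mu a b v| <= v * (1 - v) * c ->
    `|gap mu a b v| <= v * (1 - v) * (1 - c) -> `|c - 1/2| <= 2 * e.
  move=> cI g1 g2.
  have k1 : v * (1 - v) * c <= 1/4 * c by apply: ler_wpM2r => //; lra.
  have k2 : v * (1 - v) * (1 - c) <= 1/4 * (1 - c) by apply: ler_wpM2r => //; lra.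
  rewrite ler_norml; apply/andP; split; lra.
have ae := nd a aI ga ga'; have be := nd b bI gb gb'.
have L1 := copula3_fun_lipschitz mu a b v _ _ _ Fmu.1 aI bI vI hI hI hI.
have L2 := copula3_fun_lipschitz mu a b 1 _ _ _ Fmu.1 aI bI oI hI hI oI.
rewrite subrr normr0 addr0 in L2.
have c2I : 0 <= copula3_fun mu (1/2) (1/2) 1 <= 1.
  have [_ -> _ _ [s1 _ _ _]] := octant_sums mu _ _ _ Fmu hI hI hI.
  move: s1 (cell_ge0 mu (lev (fun x => x.1.1) (1/2)) (lev (fun x => x.1.2) (1/2))
    (lev (fun x => x.2) (1/2))); rewrite /octant => s1 c0.
  by have := c0 true true true; have := c0 true true false;
    have := c0 true false true; have := c0 true false false; lra.
(* Here 10 e = 5 e + 4 e + e, from C at level v, from C at level 1, and from the factor v. *)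
suff : `|gap mu a b v - gap mu (1/2) (1/2) (1/2)| <= 10 * e.
  by have := ler_distD 0 (gap mu a b v) (gap mu (1/2) (1/2) (1/2));
   have := lerB_dist (gap mu a b v) (gap mu (1/2) (1/2) (1/2)); lra.
rewrite /gap.
move: L1 L2 c2I; set C1 := copula3_fun mu a b v; set C2 := copula3_fun mu a b 1.
set D1 := copula3_fun mu _ _ _; set D2 := copula3_fun mu _ _ _ => L1 L2 c2I.
have -> : C1 - v * C2 - (D1 - 1/2 * D2) = (C1 - D1) - (v * (C2 - D2) + (v - 1/2) * D2).
  by ring.
apply: le_trans (ler_normB _ _) _.
have k1 : `|v * (C2 - D2) + (v - 1/2) * D2| <= `|C2 - D2| + `|v - 1/2|.
  apply: le_trans (ler_normD _ _) _; rewrite !normrM; apply: lerD.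
    by rewrite ler_piMl// ger0_norm; lra.
  by rewrite ler_piMr// ger0_norm; lra.
lra.
Qed.

(** * The sharp bound and its equality case *)

Theorem theorem5p2 (R : realType) (mu : probability (R * R * R)%type R)
    (K : R.-pker R ~> (R * R)%type) (Ct : R -> R -> R -> R) :
  in_F3Pi mu ->
  is_rcd mu K ->
  is_cond_copulas K Ct ->
  (forall s1 s2, measurable_fun I01 (fun t => Ct t s1 s2)) ->
  d_inf_psi mu K Ct <= 1/8 /\
  (d_inf_psi mu K Ct = 1/8 <-> condition_b mu).
Proof.
move=> Fmu rcd cond mCt.
rewrite condition_bP// /d_inf_psi; set S := [set _ | _ in _].
have hI : 0 <= (1/2 : R) <= 1 by lra.
have SE (a b v : R) : 0 <= a <= 1 -> 0 <= b <= 1 -> 0 <= v <= 1 ->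
    copula3_fun mu a b v - psi K Ct a b v = gap mu a b v.
  by move=> aI bI vI; rewrite (psiE mu).
have inS (a b v : R) : 0 <= a <= 1 -> 0 <= b <= 1 -> 0 <= v <= 1 -> S `|gap mu a b v|.
  move=> aI bI vI; exists (a, b, v); last by rewrite /= SE.
  by rewrite /I01/= !in_itv/=.
(* Averaging the bounds with a and 1-a gives v (1-v)/2 <= 1/8. *)
have Sub : ubound S (1/8).
  move=> _ [[[a b] v] + <-] /=; rewrite /I01/= !in_itv/= => -[[aI bI] vI].
  rewrite SE//; have [ga ga' _ _] := gap_le mu a b v Fmu aI bI vI.
  by have := sqr_ge0 (v - 1/2); rewrite expr2; lra.
(* This makes [sup] a genuine least upper bound rather than a default value. *)
have hS : has_sup S.
  by split; [exists `|gap mu (1/2) (1/2) (1/2)|; exact: inS|exists (1/8)].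
have supS : sup S <= 1/8 by apply: ge_sup => //; case: hS.
have half : `|gap mu (1/2) (1/2) (1/2)| <= sup S by apply: sup_upper_bound => //; exact: inS.
split=> //; split=> [supE|halfE]; last by apply/eqP; rewrite eq_le supS -halfE.
apply/eqP; rewrite eq_le -{1}supE half /=.
apply/ler_addgt0Pr => e e0.
(* The 1 meets the side condition of [gap_half_ge]; e/20 keeps its loss 20 e' below e. *)
pose e' := Num.min 1 (e / 20).
have e'e : e' <= e / 20 by rewrite /e' ge_min lexx orbT.
have e'0 : 0 < e' by rewrite /e' lt_min ltr01 /=; lra.
have e'1 : e' <= 1 by rewrite /e' ge_min lexx.
have : 0 < e' ^+ 2 / 2 by rewrite divr_gt0// exprn_gt0.
move=> /sup_adherent /(_ hS)[_ [[[a b] v] + <-]] /=.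
rewrite /I01/= !in_itv/= => -[[aI bI] vI]; rewrite SE// supE => gt.
have e'I : 0 < e' <= 1 by rewrite e'0.
have := gap_half_ge mu a b v e' Fmu aI bI vI e'I gt; lra.
Qed.
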